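(* For each update step $i\in[n]$, the Sliding Window Attention algorithm (described in the context) with window size $W>0$, run on a stream of triples $(q_i,k_i,v_i)\in(\mathbb{R}^d)^3$, produces an unbiased estimator $O_i\in\mathbb{R}^d$ of the sliding window attention function; that is, $$\mathbb{E}[O_{ij}]=\operatorname{Attn}_W(q_i,K_i,V_i)_j\quad\text{for all } j\in[d].$$ Furthermore, the algorithm uses $O(dW)$ space and $O(dW)$ time per update step.
   Context: The input is a stream of $n$ triples $(q_i,k_i,v_i)\in(\mathbb{R}^d)^3$. $K_i$ and $V_i$ are the $i\times d$ matrices whose rows are $k_1^T,\dots,k_i^T$ and $v_1^T,\dots,v_i^T$. Sliding window attention with unmasked values: let $S_i:=K_iq_i\in\mathbb{R}^i$, let $M\in\mathbb{R}^i$ be the mask $M_\ell=\mathbb{1}\{\ell>i-W\}$, and $h(S_i):=S_i\circ M$ (element-wise product). Then $\operatorname{Attn}_W(q_i,K_i,V_i):=\sigma(h(S_i))^TV_i\in\mathbb{R}^d$, where $\sigma$ is the softmax on $\mathbb{R}^i$; i.e. for $i>W$ the softmax is taken of the scores $(0,\dots,0,q_i^Tk_{i-W+1},\dots,q_i^Tk_i)$, and positions outside the window still contribute their value vectors with unnormalized weight $1$. Sliding Window Attention algorithm (window size $W$). Maintain lists $K,V$ of stored keys and values, initially empty. (1) For $i=1,\dots,W$: receive $(q_i,k_i,v_i)$; append $k_i$ to $K$ and $v_i$ to $V$; output $\operatorname{Attn}_W(q_i,K,V)$ by direct calculation. (2) Initialize $v_s\leftarrow\emptyset$ (a stored value vector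 from outside the window). (3) For $i=W+1,\dots,n$: receive $(q_i,k_i,v_i)$; pop the first (oldest) element of $V$, calling it $v$, and remove the first element of $K$; append $k_i$ to $K$ and $v_i$ to $V$; with probability $(i-W)^{-1}$ replace $v_s\leftarrow v$ (reservoir sampling); let $S:=(i-W)+\sum_{k\in K}e^{q_i^Tk}$; with probability $(S-i+W)/S$ sample $\ell\in\{i-W+1,\dots,i\}$ with probability proportional to $e^{q_i^Tk_\ell}$ and output $v_\ell$; otherwise output $v_s$. $O_i$ denotes the output at step $i$ and $O_{ij}$ its $j$-th coordinate. Space is counted as the number of stored scalars (real coordinates). *)

(* Defs.v *)
From HB Require Import structures.
From mathcomp Require Import all_boot all_order all_algebra.
From mathcomp Require Import finmap reals sequences exp.

Set Implicit Arguments.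
Unset Strict Implicit.
Unset Printing Implicit Defensive.

Import Order.TTheory GRing.Theory Num.Theory.
Local Open Scope ring_scope.

Section Attention.
Variable R : realType.

Definition softmax (m : nat) (x : 'cV[R]_m) : 'cV[R]_m :=
  \col_l (expR (x l 0) / \sum_(l' < m) expR (x l' 0)).

(* Positions are numbered from 0 here, so that position [l] is the (l+1)-st
   one and the condition l+1 > m - W reads [m < l.+1 + W]. *)
Definition window_mask (W m : nat) : 'cV[R]_m :=
  \col_(l < m) ((m < l.+1 + W)%N)%:R.

(* The masked score of a position outside the window is 0 (not -oo): such a
   position keeps unnormalized weight exp 0 = 1. *)
Definition attn (W m d : nat) (q : 'cV[R]_d) (K V : 'M[R]_(m, d)) : 'rV[R]_d :=
  (softmax (map2_mx *%R (K *m q) (window_mask W m)))^T *m V.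

(* The matrix whose rows are the transposes of x_0, ..., x_i. *)
Definition prefix_mx (n d : nat) (x : 'I_n -> 'cV[R]_d) (i : 'I_n) :
    'M[R]_(i.+1, d) :=
  \matrix_(l < i.+1) (x (widen_ord (ltn_ord i) l))^T.

End Attention.

Section Distributions.
Variable R : realType.

(* Finitely supported probability distributions; an outcome may be listed
   several times. *)
Record fdist (A : Type) := FDist {
  fdist_list : seq (R * A);
  fdist_ge0 : all (fun x => 0 <= x.1) fdist_list;
  fdist_sum1 : \sum_(x <- fdist_list) x.1 = 1 }.

Definition expect (A : Type) (mu : fdist A) (f : A -> R) : R :=
  \sum_(x <- fdist_list mu) x.1 * f x.2.

Definition prob (A : Type) (mu : fdist A) (E : pred A) : R :=
  expect mu (fun a => (E a)%:R).

Section Return.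
Variables (A : Type) (a : A).

Let dret_list : seq (R * A) := [:: (1, a)].

Fact dret_ge0 : all (fun x => 0 <= x.1) dret_list.
Proof. by rewrite /= ler01. Qed.

Fact dret_sum1 : \sum_(x <- dret_list) x.1 = 1.
Proof. by rewrite big_seq1. Qed.

Definition dret : fdist A := FDist dret_ge0 dret_sum1.

End Return.

Section Bind.
Variables (A B : Type) (mu : fdist A) (f : A -> fdist B).

Let dbind_list : seq (R * B) :=
  flatten [seq [seq (x.1 * y.1, y.2) | y <- fdist_list (f x.2)]
          | x <- fdist_list mu].

Fact dbind_ge0 : all (fun x => 0 <= x.1) dbind_list.
Proof.
rewrite /dbind_list; elim: (fdist_list mu) (fdist_ge0 mu) => //= x s IHs.
case/andP=> x_ge0 /IHs s_ge0; rewrite all_cat s_ge0 andbT all_map.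
by apply: sub_all (fdist_ge0 (f x.2)) => y /= y_ge0; rewrite mulr_ge0.
Qed.

Fact dbind_sum1 : \sum_(x <- dbind_list) x.1 = 1.
Proof.
rewrite big_flatten big_map -(fdist_sum1 mu); apply: eq_bigr => x _.
by rewrite big_map -mulr_sumr fdist_sum1 mulr1.
Qed.

Definition dbind : fdist B := FDist dbind_ge0 dbind_sum1.

End Bind.

Section Bernoulli.
Variable p : R.

(* Only 0 <= p <= 1 is meaningful; other values are clamped. *)
Let c : R := Num.max 0 (Num.min 1 p).
Let bernoulli_list : seq (R * bool) := [:: (c, true); (1 - c, false)].

Fact bernoulli_ge0 : all (fun x => 0 <= x.1) bernoulli_list.
Proof. by rewrite /= subr_ge0 /c le_max lexx ge_max ler01 ge_min lexx. Qed.

Fact bernoulli_sum1 : \sum_(x <- bernoulli_list) x.1 = 1.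
Proof. by rewrite big_cons big_seq1 /= addrC subrK. Qed.

Definition bernoulli : fdist bool := FDist bernoulli_ge0 bernoulli_sum1.

End Bernoulli.

Section Categorical.
Variable w : seq R.

(* The index [l < size w] is drawn with probability proportional to [w`_l].
   Only nonnegative weights with a positive sum are meaningful; negative
   weights count as 0, and 0 is returned if no weight is positive. *)
Let total : R := \sum_(x <- w) Num.max 0 x.
Let categorical_list : seq (R * nat) :=
  if total == 0 then [:: (1, 0%N)]
  else [seq (Num.max 0 w`_l / total, l) | l <- iota 0 (size w)].

Fact categorical_ge0 : all (fun x => 0 <= x.1) categorical_list.
Proof.
rewrite /categorical_list; case: ifP => _; first by rewrite /= ler01.
rewrite all_map; apply/allP => l _ /=.
by rewrite divr_ge0 ?sumr_ge0 // => [|x _]; rewrite le_max lexx.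
Qed.

Fact categorical_sum1 : \sum_(x <- categorical_list) x.1 = 1.
Proof.
rewrite /categorical_list; case: (eqVneq total 0) => [_|total_neq0].
  by rewrite big_seq1.
rewrite big_map -mulr_suml (_ : iota 0 _ = index_iota 0 (size w)).
  by rewrite -(big_nth 0 xpredT (Num.max 0)) divff.
by rewrite /index_iota subn0.
Qed.

Definition categorical : fdist nat := FDist categorical_ge0 categorical_sum1.

End Categorical.

End Distributions.

(* A real RAM. Every real number that the machine manipulates sits in a memory
   cell addressed by (array, row, column), and each elementary instruction
   costs one unit of time. The bounds of loops and the indices of the
   addressed cells are integers; they are computed outside the language and,
   as each use accompanies an instruction, are not charged separately. *)
Definition addr := (nat * nat * nat)%type.

Inductive arith := Plus | Minus | Times | Over.

Inductive cmd :=
| Skip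
| Const of addr & nat
| Move of addr & addr
| Arith of arith & addr & addr & addr
| Exp of addr & addr
| Seq of cmd & cmd
(* [Flip a c1 c2] runs [c1] with the probability stored in [a], else [c2]. *)
| Flip of addr & cmd & cmd
(* [Draw w k] draws a position [l] in the list [w] of cells, with probability
   proportional to their contents, and runs [k l]. *)
| Draw of seq addr & (nat -> cmd).

Fixpoint loop (n : nat) (body : nat -> cmd) : cmd :=
  if n is n'.+1 then Seq (loop n' body) (body n') else Skip.

Declare Scope cmd_scope.
Delimit Scope cmd_scope with cmd.
Notation "c1 ;; c2" := (Seq c1 c2)
  (at level 100, c2 at level 200, right associativity) : cmd_scope.

Section Semantics.
Variable R : realType.

(* The memory contains exactly the cells written so far. *)
Definition memory := {fmap addr -> R}.
Definition read (m : memory) (a : addr) : R := odflt 0 (m.[? a])%fmap.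
Definition write (m : memory) (a : addr) (x : R) : memory := (m.[a <- x])%fmap.
Definition space (m : memory) : nat := #|` domf m|%fset.

Record outcome := Outcome {
  final : memory;
  time : nat;
  peak : nat  (* the maximum of [space] during the execution *) }.

Definition charge (t : nat) (m : memory) (o : outcome) : outcome :=
  Outcome (final o) (t + time o) (maxn (space m) (peak o)).

Definition idle (m : memory) : outcome := Outcome m 0 (space m).

Definition arith_fun (o : arith) : R -> R -> R :=
  match o with
  | Plus => fun x y => x + y
  | Minus => fun x y => x - y
  | Times => fun x y => x * y
  | Over => fun x y => x / y
  end.

(* [Draw] costs one unit per weight (inverse transform sampling). *)
Fixpoint run (c : cmd) (m : memory) : fdist R outcome :=
  let assign a x := dret R (charge 1 m (idle (write m a x))) in
  match c with
  | Skip => dret R (idle m)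
  | Const a n => assign a n%:R
  | Move a b => assign a (read m b)
  | Arith o a b1 b2 => assign a (arith_fun o (read m b1) (read m b2))
  | Exp a b => assign a (expR (read m b))
  | Seq c1 c2 =>
      dbind (run c1 m) (fun o1 =>
      dbind (run c2 (final o1)) (fun o2 =>
      dret R (Outcome (final o2) (time o1 + time o2)
                      (maxn (peak o1) (peak o2)))))
  | Flip a c1 c2 =>
      dbind (bernoulli (read m a)) (fun b =>
      dbind (run (if b then c1 else c2) m) (fun o =>
      dret R (charge 1 m o)))
  | Draw w k =>
      dbind (categorical [seq read m a | a <- w]) (fun l =>
      dbind (run (k l) m) (fun o =>
      dret R (charge (size w) m o)))
  end.

End Semantics.

(* The memory layout of the algorithm. Row [l] of [cK] and [cV] is the
   (l+1)-st oldest element of the corresponding list. *)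
Definition cK (l j : nat) : addr := (0, l, j)%N.
Definition cV (l j : nat) : addr := (1, l, j)%N.
Definition cvs (j : nat) : addr := (2, 0, j)%N.
Definition cq (j : nat) : addr := (3, 0, j)%N.
Definition ck (j : nat) : addr := (4, 0, j)%N.
Definition cv (j : nat) : addr := (5, 0, j)%N.
Definition cpop (j : nat) : addr := (6, 0, j)%N.
Definition cout (j : nat) : addr := (7, 0, j)%N.
Definition cweight (l : nat) : addr := (8, l, 0)%N.
Definition cS : addr := (9, 0, 0)%N.
Definition ccount : addr := (9, 0, 1)%N.
Definition cp : addr := (9, 0, 2)%N.
Definition ctmp : addr := (9, 0, 3)%N.

Section Algorithm.
Local Open Scope cmd_scope.
Variables (d W : nat).

Definition copy (dst src : nat -> addr) : cmd :=
  loop d (fun j => Move (dst j) (src j)).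

(* Removal of the first of the [W] rows of [A]. *)
Definition shift (A : nat -> nat -> addr) : cmd :=
  loop W.-1 (fun l => copy (A l) (A l.+1)).

(* cweight l <- exp (q . k_l) for l < len. *)
Definition weights (len : nat) : cmd :=
  loop len (fun l =>
    Const (cweight l) 0 ;;
    loop d (fun j =>
      Arith Times ctmp (cq j) (cK l j) ;;
      Arith Plus (cweight l) (cweight l) ctmp) ;;
    Exp (cweight l) (cweight l)).

(* cS <- cS + \sum_(l < len) cweight l. *)
Definition add_weights (len : nat) : cmd :=
  loop len (fun l => Arith Plus cS cS (cweight l)).

(* A step i <= W. Every position is in the window, and the attention is
   \sum_l (exp (q . k_l) / \sum_l' exp (q . k_l')) v_l. *)
Definition early_step (i : nat) : cmd :=
  copy (cK i.-1) ck ;;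
  copy (cV i.-1) cv ;;
  weights i ;;
  Const cS 0 ;;
  add_weights i ;;
  loop d (fun j => Const (cout j) 0) ;;
  loop i (fun l =>
    Arith Over cp (cweight l) cS ;;
    loop d (fun j =>
      Arith Times ctmp cp (cV l j) ;;
      Arith Plus (cout j) (cout j) ctmp)).

Definition late_step (i : nat) : cmd :=
  copy cpop (cV 0) ;;
  shift cV ;;
  shift cK ;;
  copy (cK W.-1) ck ;;
  copy (cV W.-1) cv ;;
  Const ccount (i - W) ;;
  Const cp 1 ;;
  Arith Over cp cp ccount ;;
  Flip cp (copy cvs cpop) Skip ;;
  weights W ;;
  Move cS ccount ;;
  add_weights W ;;
  Arith Minus cp cS ccount ;;
  Arith Over cp cp cS ;;
  Flip cp
    (Draw [seq cweight l | l <- iota 0 W] (fun l => copy cout (cV l)))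
    (copy cout cvs).

Definition sw_step (i : nat) : cmd :=
  if (i <= W)%N then early_step i else late_step i.

End Algorithm.

Section Execution.
Variables (R : realType) (d W : nat).

Record triple := Triple { query : 'cV[R]_d; key : 'cV[R]_d; value : 'cV[R]_d }.

Definition store (a : nat -> addr) (x : 'cV[R]_d) (m : memory R) : memory R :=
  foldl (fun m (j : 'I_d) => write m (a j) (x j 0)) m (enum 'I_d).

Definition receive (x : triple) (m : memory R) : memory R :=
  store cv (value x) (store ck (key x) (store cq (query x) m)).

(* Step [i] from the memory [m] left by the previous step. Receiving the
   triple costs one unit of time per coordinate. *)
Definition update (i : nat) (x : triple) (m : memory R) : fdist R (outcome R) :=
  let m' := receive x m in
  dbind (run (sw_step d W i) m') (fun o => dret R (charge (3 * d) m' o)).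

(* The law of the memory after the steps [i, i + 1, ...] on the triples
   [xs], starting from the memory [m]. *)
Fixpoint process (i : nat) (xs : seq triple) (m : memory R) :
    fdist R (memory R) :=
  if xs is x :: xs' then
    dbind (update i x m) (fun o => process i.+1 xs' (final o))
  else dret R m.

(* The law of the outcome of step i+1, the first step being step 1. *)
Definition sw_law (n : nat) (s : n.-tuple triple) (i : 'I_n) :
    fdist R (outcome R) :=
  dbind (process 1 (take i s) [fmap]%fmap) (fun m => update i.+1 (tnth s i) m).

Definition output (o : outcome R) (j : 'I_d) : R := read (final o) (cout j).

End Execution.

(* Main.v *)
Require Import Defs.
From mathcomp Require Import all_boot all_order all_algebra.
From mathcomp Require Import finmap reals sequences exp.
From mathcomp Require Import zify ring.

(* Whatever the coin tosses, after step [i] the lists hold the last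
   [min i W] keys and values. Given the memory left by step [i] (with
   [W <= i], and [c = i + 1 - W]), the conditional mean of the output of step
   [i + 1] is affine in the old reservoir content [v_s]:
     (\sum_(l in window) w_l v_l + v + (c - 1) v_s) / (c + \sum_l w_l),
   where [v] is the value that leaves the window. So unbiasedness only needs
   the mean of [v_s], and [(c - 1) E[v_s]] is the sum of the values outside
   the old window: each replacement turns the mean [e] into [v / c + (1 - 1 / c) e].
   For the resources, all addresses written lie in a fixed set of at most
   [13 d W] cells, and the lengths of the loops bound the time of every
   execution path. *)

Set Implicit Arguments.
Unset Strict Implicit.
Unset Printing Implicit Defensive.

Import Order.TTheory GRing.Theory Num.Theory.
Local Open Scope ring_scope.

(** * Finite distributions *)

Section Expectation.
Variable R : realType.

Lemma eq_expect (A : Type) (mu : fdist R A) (f g : A -> R) :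
  f =1 g -> expect mu f = expect mu g.
Proof. by move=> fg; apply: eq_bigr => x _; rewrite fg. Qed.

Lemma expect_dret (A : Type) (a : A) (f : A -> R) : expect (dret R a) f = f a.
Proof. by rewrite /expect big_seq1 mul1r. Qed.

Lemma expect_dbind (A B : Type) (mu : fdist R A) (k : A -> fdist R B) f :
  expect (dbind mu k) f = expect mu (fun a => expect (k a) f).
Proof.
rewrite /expect big_flatten big_map; apply: eq_bigr => x _.
by rewrite big_map mulr_sumr; apply: eq_bigr => y _; rewrite mulrA.
Qed.

Lemma expect_const (A : Type) (mu : fdist R A) (c : R) : expect mu (fun=> c) = c.
Proof. by rewrite /expect -mulr_suml fdist_sum1 mul1r. Qed.

Lemma expectD (A : Type) (mu : fdist R A) (f g : A -> R) :
  expect mu (fun a => f a + g a) = expect mu f + expect mu g.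
Proof. by rewrite /expect -big_split; apply: eq_bigr => x _; rewrite mulrDr. Qed.

Lemma expectZ (A : Type) (mu : fdist R A) (c : R) (f : A -> R) :
  expect mu (fun a => c * f a) = c * expect mu f.
Proof. by rewrite /expect mulr_sumr; apply: eq_bigr => x _; rewrite mulrCA. Qed.

Lemma expect_bernoulli (p : R) (f : bool -> R) : 0 <= p <= 1 ->
  expect (bernoulli p) f = p * f true + (1 - p) * f false.
Proof.
case/andP=> p0 p1; rewrite /expect big_cons big_seq1 /=.
by rewrite min_r // max_r.
Qed.

Lemma expect_categorical (w : seq R) (f : nat -> R) :
    all (fun x => 0 <= x) w -> 0 < \sum_(x <- w) x ->
  expect (categorical w) f =
  (\sum_(l < size w) w`_l * f l) / \sum_(x <- w) x.
Proof.
move=> /allP w0 sw0; rewrite /expect /=.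
have -> : \sum_(x <- w) Num.max 0 x = \sum_(x <- w) x.
  by apply: eq_big_seq => x /w0 x0; rewrite max_r.
rewrite gt_eqF // big_map mulr_suml (_ : iota 0 _ = index_iota 0 (size w)).
  rewrite big_mkord; apply: eq_bigr => l _ /=.
  by rewrite max_r ?w0 ?mem_nth // mulrAC.
by rewrite /index_iota subn0.
Qed.

(* This says that the outcomes violating [P] have total mass 0, in the form
   that composes with [dbind] and needs no decidability of [P]. *)
Definition surely (A : Type) (mu : fdist R A) (P : A -> Prop) :=
  forall f g : A -> R, (forall a, P a -> f a = g a) -> expect mu f = expect mu g.

Lemma surelyT (A : Type) (mu : fdist R A) (P : A -> Prop) :
  (forall a, P a) -> surely mu P.
Proof. by move=> PT f g fg; apply: eq_expect => a; apply: fg. Qed.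

Lemma surelyW (A : Type) (mu : fdist R A) (P Q : A -> Prop) :
  (forall a, P a -> Q a) -> surely mu P -> surely mu Q.
Proof. by move=> PQ muP f g fg; apply: muP => a /PQ; apply: fg. Qed.

Lemma surely_dret (A : Type) (a : A) (P : A -> Prop) : P a -> surely (dret R a) P.
Proof. by move=> Pa f g fg; rewrite !expect_dret fg. Qed.

Lemma surely_dbind (A B : Type) (mu : fdist R A) (k : A -> fdist R B) P Q :
    surely mu P -> (forall a, P a -> surely (k a) Q) ->
  surely (dbind mu k) Q.
Proof.
move=> muP kQ f g fg; rewrite !expect_dbind.
by apply: muP => a /kQ; apply.
Qed.

Lemma surely_prob (A : Type) (mu : fdist R A) (E : pred A) :
  surely mu E -> prob mu E = 1.
Proof.
move=> muE; rewrite -[RHS](expect_const mu 1).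
by apply: muE => a ->.
Qed.

End Expectation.

(** * Semantics of commands *)

Section Memory.
Variable R : realType.
Implicit Types (m : memory R) (a b : addr).

Lemma read_write m a x b : read (write m a x) b = if b == a then x else read m b.
Proof. by rewrite /read /write fnd_set; case: eqP. Qed.

(** Without [Flip] and [Draw] the law of the outcome is a point mass, so [exec] can replace the
    distribution by a plain function on memories, whose effect is computed by rewriting. *)
Fixpoint det (c : cmd) : bool :=
  match c with
  | Seq c1 c2 => det c1 && det c2
  | Flip _ _ _ | Draw _ _ => false
  | _ => true
  end.

(** The value [m] on [Flip] and [Draw] is a dummy; [exec] describes the run only under [det]. *)
Fixpoint exec (c : cmd) (m : memory R) : memory R :=
  match c with
  | Const a n => write m a n%:R
  | Move a b => write m a (read m b)
  | Arith o a b1 b2 => write m a (arith_fun o (read m b1) (read m b2))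
  | Exp a b => write m a (expR (read m b))
  | Seq c1 c2 => exec c2 (exec c1 m)
  | _ => m
  end.

Lemma det_loop n body : (forall l, det (body l)) -> det (loop n body).
Proof. by move=> db; elim: n => //= n ->; rewrite db. Qed.

(** The weakest preexpectation of [g]; the [mean_] lemmas below are its calculus. *)
Definition mean (c : cmd) (m : memory R) (g : memory R -> R) : R :=
  expect (run c m) (fun o => g (final o)).

Lemma mean_seq c1 c2 m g :
  mean (Seq c1 c2) m g = mean c1 m (fun m1 => mean c2 m1 g).
Proof.
rewrite /mean /= expect_dbind; apply: eq_expect => o1.
by rewrite expect_dbind; apply: eq_expect => o2; rewrite expect_dret.
Qed.

Lemma mean_det c m g : det c -> mean c m g = g (exec c m).
Proof.
elim: c m g => //= [|a n|a b|o a b1 b2|a b|c1 IH1 c2 IH2] m g;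
  try by rewrite /mean expect_dret.
by case/andP=> d1 d2; rewrite mean_seq IH1 // IH2.
Qed.

Lemma mean_seq_det c1 c2 m g : det c1 ->
  mean (Seq c1 c2) m g = mean c2 (exec c1 m) g.
Proof. by move=> d1; rewrite mean_seq mean_det. Qed.

Lemma mean_flip a c1 c2 m g : 0 <= read m a <= 1 ->
  mean (Flip a c1 c2) m g =
  read m a * mean c1 m g + (1 - read m a) * mean c2 m g.
Proof.
move=> p01; rewrite /mean /= expect_dbind expect_bernoulli // !expect_dbind.
by congr (_ * _ + _ * _); apply: eq_expect => o; rewrite expect_dret.
Qed.

Lemma mean_draw w k m g :
    all (fun a => 0 <= read m a) w -> 0 < \sum_(a <- w) read m a ->
  mean (Draw w k) m g =
  (\sum_(l < size w) read m (nth (0, 0, 0)%N w l) * mean (k l) m g)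
    / \sum_(a <- w) read m a.
Proof.
move=> w0 sw0; rewrite /mean /= expect_dbind expect_categorical ?all_map ?big_map //.
rewrite size_map; congr (_ / _); apply: eq_bigr => l _.
rewrite (nth_map (0, 0, 0)%N) // expect_dbind; congr (_ * _).
by apply: eq_expect => o; rewrite expect_dret.
Qed.

Definition sure (c : cmd) (m : memory R) (Q : memory R -> Prop) :=
  surely (run c m) (fun o => Q (final o)).

Lemma sureW c m (P Q : memory R -> Prop) :
  (forall m', P m' -> Q m') -> sure c m P -> sure c m Q.
Proof. by move=> PQ; apply: surelyW => o; apply: PQ. Qed.

Lemma sure_seq c1 c2 m Q :
  sure c1 m (fun m1 => sure c2 m1 Q) -> sure (Seq c1 c2) m Q.
Proof.
move=> s1; apply: (surely_dbind s1) => o1 s2.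
by apply: (surely_dbind s2) => o2 Qo; apply: surely_dret.
Qed.

Lemma sure_det c m Q : det c -> Q (exec c m) -> sure c m Q.
Proof.
elim: c m Q => //= [|a n|a b|o a b1 b2|a b|c1 IH1 c2 IH2] m Q;
  try by move=> _ Qm; apply: surely_dret.
by case/andP=> d1 d2 Qm; apply/sure_seq/IH1/IH2.
Qed.

Lemma sure_flip a c1 c2 m Q :
  sure c1 m Q -> sure c2 m Q -> sure (Flip a c1 c2) m Q.
Proof.
move=> s1 s2; apply: (@surely_dbind _ _ _ _ _ (fun=> True)); first exact: surelyT.
move=> b _; have sb : sure (if b then c1 else c2) m Q by case: b.
by apply: (surely_dbind sb) => o Qo; apply: surely_dret.
Qed.

Lemma sure_draw w k m Q : (forall l, sure (k l) m Q) -> sure (Draw w k) m Q.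
Proof.
move=> sk; apply: (@surely_dbind _ _ _ _ _ (fun=> True)); first exact: surelyT.
move=> l _; apply: (surely_dbind (sk l)) => o Qo.
exact: surely_dret.
Qed.

(** The domain of the memory never leaves the fixed set [A], so the cardinal of [A] bounds the peak.
    Quantifying over every memory inside [A] lets the time bounds add up along [Seq]. *)
Definition safe (A : {fset addr}) (c : cmd) (T : nat) :=
  forall m, (domf m `<=` A)%fset ->
  surely (run c m) (fun o =>
    [/\ (domf (final o) `<=` A)%fset, peak o <= #|` A| & time o <= T]%N).

Lemma safe_le A c T T' : (T <= T')%N -> safe A c T -> safe A c T'.
Proof.
move=> TT' sc m /sc; apply: surelyW => o [dA pA tT]; split=> //.
exact: leq_trans TT'.
Qed.

Lemma space_subset A m : (domf m `<=` A)%fset -> (Defs.space m <= #|` A|)%N.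
Proof. exact: fsubset_leq_card. Qed.

Lemma write_sub A m a x : a \in A -> (domf m `<=` A)%fset ->
  (domf (write m a x) `<=` A)%fset.
Proof. by move=> aA mA; rewrite fsubUset fsub1set aA. Qed.

Lemma safe_skip A : safe A Skip 0.
Proof. by move=> m mA; apply: surely_dret; split=> //=; apply: space_subset. Qed.

Lemma safe_assign A a x m : a \in A -> (domf m `<=` A)%fset ->
  surely (dret R (charge 1 m (idle (write m a x)))) (fun o =>
    [/\ (domf (final o) `<=` A)%fset, peak o <= #|` A| & time o <= 1]%N).
Proof.
move=> aA mA; have wA := write_sub x aA mA.
by apply: surely_dret; split=> //=; rewrite geq_max !space_subset.
Qed.

Lemma safe_const A a n : a \in A -> safe A (Const a n) 1.
Proof. by move=> aA m; apply: safe_assign. Qed.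

Lemma safe_move A a b : a \in A -> safe A (Move a b) 1.
Proof. by move=> aA m; apply: safe_assign. Qed.

Lemma safe_arith A o a b1 b2 : a \in A -> safe A (Arith o a b1 b2) 1.
Proof. by move=> aA m; apply: safe_assign. Qed.

Lemma safe_exp A a b : a \in A -> safe A (Exp a b) 1.
Proof. by move=> aA m; apply: safe_assign. Qed.

Lemma safe_seq A c1 c2 T1 T2 :
  safe A c1 T1 -> safe A c2 T2 -> safe A (Seq c1 c2) (T1 + T2).
Proof.
move=> s1 s2 m /s1 s1m; apply: (surely_dbind s1m) => o1 [d1 p1 t1].
apply: (surely_dbind (s2 _ d1)) => o2 [d2 p2 t2].
by apply: surely_dret; split; rewrite /= ?geq_max ?p1 // leq_add.
Qed.

Lemma safe_charged A T t m (mu : fdist R (outcome R)) :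
    (domf m `<=` A)%fset ->
    surely mu (fun o =>
      [/\ (domf (final o) `<=` A)%fset, peak o <= #|` A| & time o <= T]%N) ->
  surely (dbind mu (fun o => dret R (charge t m o))) (fun o =>
    [/\ (domf (final o) `<=` A)%fset, peak o <= #|` A| & time o <= t + T]%N).
Proof.
move=> mA s; apply: (surely_dbind s) => o [dA pA tT].
by apply: surely_dret; split; rewrite /= ?geq_max ?space_subset ?leq_add2l.
Qed.

Lemma safe_flip A a c1 c2 T :
  safe A c1 T -> safe A c2 T -> safe A (Flip a c1 c2) (1 + T).
Proof.
move=> s1 s2 m mA.
apply: (@surely_dbind _ _ _ _ _ (fun=> True)); first exact: surelyT.
by move=> b _; apply: safe_charged => //; case: b; [apply: s1|apply: s2].
Qed.

Lemma safe_draw A w k T :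
  (forall l, safe A (k l) T) -> safe A (Draw w k) (size w + T).
Proof.
move=> sk m mA.
apply: (@surely_dbind _ _ _ _ _ (fun=> True)); first exact: surelyT.
by move=> l _; apply: safe_charged => //; apply: sk.
Qed.

Lemma safe_loop A n body T :
  (forall l, (l < n)%N -> safe A (body l) T) -> safe A (loop n body) (n * T).
Proof.
elim: n => [|n IHn] sb /=; first exact: safe_skip.
rewrite mulSn addnC; apply: safe_seq; last exact: sb.
by apply: IHn => l ln; apply: sb; apply: ltnW.
Qed.

End Memory.

(** * Memory contents after each block *)

Section Reads.
Variable R : realType.
Implicit Types (m : memory R) (d len x y z : nat).

Lemma read_copy d a l a' l' m x y z : (a, l) != (a', l') ->
  read (exec (copy d (fun j => (a, l, j)) (fun j => (a', l', j))) m) (x, y, z) =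
  if [&& x == a, y == l & (z < d)%N] then read m (a', l', z)
  else read m (x, y, z).
Proof.
move=> al; elim: d x y z => [|d IHd] x y z /=; first by rewrite !andbF.
have al' : (a' == a) && (l' == l) = false.
  by apply: contraNF al; rewrite xpair_eqE eq_sym [l == _]eq_sym.
rewrite read_write !IHd !xpair_eqE andbA al' /= ltnS (leq_eqVlt z) -andbA.
case: (eqVneq x a) => //= _; case: (eqVneq y l) => //= _.
by case: (eqVneq z d) => [->|].
Qed.

Lemma det_copy d dst src : det (copy d dst src).
Proof. exact: det_loop. Qed.

(** Rows are overwritten in increasing order, so row [l.+1] still has its old content when it is
    copied to row [l]. *)
Lemma read_shift d W a m x y z :
  read (exec (shift d W (fun l j => (a, l, j))) m) (x, y, z) =
  if [&& x == a, (y < W.-1)%N & (z < d)%N] then read m (a, y.+1, z)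
  else read m (x, y, z).
Proof.
rewrite /shift; elim: W.-1 x y z => [|w IHw] x y z /=.
  by rewrite andbF.
rewrite read_copy ?xpair_eqE ?eqxx ?[_ == _.+1]ltn_eqF //.
rewrite !IHw eqxx /= [(w.+1 < w)%N]ltnNge leqnSn ltnS (leq_eqVlt y) /=.
by case: (x == a) => //=; case: (eqVneq y w) => [->|] //=; rewrite ltnn.
Qed.

Lemma det_shift d W A : det (shift d W A).
Proof. by apply: det_loop => l; apply: det_copy. Qed.

Lemma read_zero d a l m x y z :
  read (exec (loop d (fun j => Const (a, l, j) 0)) m) (x, y, z) =
  if [&& x == a, y == l & (z < d)%N] then 0 else read m (x, y, z).
Proof.
elim: d => [|d IHd] /=; first by rewrite !andbF.
rewrite read_write IHd !xpair_eqE ltnS (leq_eqVlt z) -andbA.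
by case: (x == a); case: (y == l) => //=; case: (z == d).
Qed.

(** The final content of the scratch cell [ctmp] is left unspecified, hence the side condition here
    and in the lemmas below. *)
Lemma read_dot d l m x y z : (x, y, z) != ctmp ->
  read (exec (loop d (fun j =>
      Seq (Arith Times ctmp (cq j) (cK l j))
          (Arith Plus (cweight l) (cweight l) ctmp))) m) (x, y, z) =
  if (x, y, z) == cweight l then
    read m (cweight l) + \sum_(j < d) read m (cq j) * read m (cK l j)
  else read m (x, y, z).
Proof.
elim: d x y z => [|d IHd] x y z xyz /=.
  by rewrite big_ord0 addr0; case: eqP => [->|].
rewrite !read_write !eqxx (negPf xyz) !IHd // !eqxx big_ord_recr /= addrA.
by case: ifP => // ->.
Qed.

Lemma read_weights d len m x y z : (x, y, z) != ctmp ->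
  read (exec (weights d len) m) (x, y, z) =
  if [&& x == 8, (y < len) & z == 0]%N then
    expR (\sum_(j < d) read m (cq j) * read m (cK y j))
  else read m (x, y, z).
Proof.
rewrite /weights; elim: len x y z => [|len IHl] x y z xyz /=.
  by rewrite andbF.
rewrite read_write !read_dot // !read_write !IHl // !eqxx add0r.
rewrite !xpair_eqE /= ltnS (leq_eqVlt y) -andbA.
(* Computing the earlier weights has changed neither the query nor the keys. *)
rewrite (eq_bigr (fun j : 'I_d => read m (cq j) * read m (cK len j))); last first.
  by move=> j _; rewrite !read_write !IHl.
by case: (x == 8%N); case: (z == 0%N); rewrite ?andbF //=; case: (eqVneq y len) => [->|].
Qed.

Lemma det_weights d len : det (weights d len).
Proof. by apply: det_loop => l /=; rewrite andbT; apply: det_loop. Qed.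

Lemma read_add_weights len m x y z :
  read (exec (add_weights len) m) (x, y, z) =
  if (x, y, z) == cS then read m cS + \sum_(l < len) read m (cweight l)
  else read m (x, y, z).
Proof.
rewrite /add_weights; elim: len x y z => [|len IHl] x y z /=.
  by rewrite big_ord0 addr0; case: eqP => [->|].
rewrite read_write !IHl /= big_ord_recr /= addrA.
by case: ifP => // ->.
Qed.

Lemma det_add_weights len : det (add_weights len).
Proof. exact: det_loop. Qed.

Lemma read_axpy d l m x y z : (x, y, z) != ctmp ->
  read (exec (loop d (fun j =>
      Seq (Arith Times ctmp cp (cV l j))
          (Arith Plus (cout j) (cout j) ctmp))) m) (x, y, z) =
  if [&& x == 7, y == 0 & (z < d)]%N then
    read m (cout z) + read m cp * read m (cV l z)
  else read m (x, y, z).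
Proof.
elim: d x y z => [|d IHd] x y z xyz /=; first by rewrite !andbF.
rewrite !read_write !eqxx (negPf xyz) !IHd // !xpair_eqE /= ltnn ltnS (leq_eqVlt z) -andbA.
by case: (x == 7%N); case: (y == 0%N) => //=; case: (eqVneq z d) => [->|].
Qed.

(** Each pass overwrites [cp] with its own coefficient, so [cp] is excluded together with [ctmp]. *)
Lemma read_combine d len m x y z : (x, y, z) != ctmp -> (x, y, z) != cp ->
  read (exec (loop len (fun l =>
    Seq (Arith Over cp (cweight l) cS)
    (loop d (fun j =>
      Seq (Arith Times ctmp cp (cV l j))
          (Arith Plus (cout j) (cout j) ctmp))))) m) (x, y, z) =
  if [&& x == 7, y == 0 & (z < d)]%N then
    read m (cout z) +
    \sum_(l < len) read m (cweight l) / read m cS * read m (cV l z)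
  else read m (x, y, z).
Proof.
elim: len x y z => [|len IHl] x y z xyz xyz' /=.
  by rewrite big_ord0 addr0; case: ifP => // /and3P[/eqP-> /eqP->].
rewrite read_axpy // !read_write eqxx (negPf xyz') !IHl // big_ord_recr /= addrA.
by case: ifP => [/and3P[_ _ ->]|->].
Qed.

End Reads.

(** * One step of the algorithm *)

Section Steps.
Variable R : realType.
Implicit Types (m : memory R) (d W i l : nat).

(* [slide] and [sample] are what [late_step] executes before and after the
   reservoir replacement. *)
Definition slide d W i : cmd :=
  (copy d cpop (cV 0) ;; shift d W cV ;; shift d W cK ;;
   copy d (cK W.-1) ck ;; copy d (cV W.-1) cv ;;
   Const ccount (i - W) ;; Const cp 1 ;; Arith Over cp cp ccount)%cmd.

Definition sample d W : cmd :=
  (weights d W ;; Move cS ccount ;; add_weights W ;;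
   Arith Minus cp cS ccount ;; Arith Over cp cp cS ;;
   Flip cp
     (Draw [seq cweight l | l <- iota 0 W] (fun l => copy d cout (cV l)))
     (copy d cout cvs))%cmd.

(** Conditioning on the reservoir coin: both branches continue with the same [sample], from memories
    that differ only in [cvs]. *)
Lemma mean_late_step d W i m g : (W < i)%N ->
  mean (late_step d W i) m g =
  (i - W)%:R^-1 * mean (sample d W) (exec (copy d cvs cpop) (exec (slide d W i) m)) g
  + (1 - (i - W)%:R^-1) * mean (sample d W) (exec (slide d W i) m) g.
Proof.
move=> Wi; have cp_val : read (exec (slide d W i) m) cp = (i - W)%:R^-1.
  by rewrite /= !read_write /= div1r.
rewrite /late_step !(mean_seq_det _ _ _ (det_copy _ _ _)).
rewrite !(mean_seq_det _ _ _ (det_shift _ _ _)) !(mean_seq_det _ _ _ (det_copy _ _ _)).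
(* The memory reached just before the coin is convertible to the result of [slide]. *)
do 3![rewrite mean_seq_det //]; rewrite mean_seq -[exec (Arith _ _ _ _) _]/(exec (slide d W i) m).
rewrite mean_flip cp_val; last first.
  (* [W < i] keeps the probability in the range where [bernoulli] does not clamp. *)
  by rewrite invr_ge0 ler0n invf_le1 ?ltr0n ?subn_gt0 // ler1n subn_gt0.
by rewrite (mean_det _ _ (det_copy _ _ _)) (@mean_det _ Skip).
Qed.

Lemma sure_late_step d W i m Q :
    sure (sample d W) (exec (copy d cvs cpop) (exec (slide d W i) m)) Q ->
    sure (sample d W) (exec (slide d W i) m) Q ->
  sure (late_step d W i) m Q.
Proof.
move=> s1 s2; do 8![apply/sure_seq/sure_det; rewrite ?det_copy ?det_shift //].
apply/sure_seq/sure_flip; apply/sure_det => //; exact: det_copy.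
Qed.

(** Arrays 0 to 6 hold the lists, the reservoir, the received triple and the popped value; sampling
    writes only to the output, the weights and the registers, numbered from 7 on. *)
Lemma sample_frame d W m :
  sure (sample d W) m (fun m' => forall x y z, (x < 7)%N ->
    read m' (x, y, z) = read m (x, y, z)).
Proof.
do 5![apply/sure_seq/sure_det; rewrite ?det_weights ?det_add_weights //].
apply: sure_flip.
  apply: sure_draw => l; apply: sure_det; first exact: det_copy.
  (* With a concrete array number, the comparisons of addresses compute. *)
  case=> [|[|[|[|[|[|[|x]]]]]]] // y z _;
  by rewrite read_copy //= !read_write read_add_weights !read_write read_weights.
apply: sure_det; first exact: det_copy.
case=> [|[|[|[|[|[|[|x]]]]]]] // y z _;
by rewrite read_copy //= !read_write read_add_weights !read_write read_weights.
Qed.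

(** With [c] the count and [s] the total weight of the window, the coin selects the weighted mean of
    the window, which has denominator [s], with probability [s / (c + s)], and [v_s] with
    probability [c / (c + s)]; the factor [s] cancels. *)
Lemma mean_sample_out d W m (j : 'I_d) : (0 < W)%N -> 0 < read m ccount ->
  let w l := expR (\sum_(j < d) read m (cq j) * read m (cK l j)) in
  mean (sample d W) m (fun m' => read m' (cout j)) =
  (read m ccount * read m (cvs j) + \sum_(l < W) w l * read m (cV l j))
  / (read m ccount + \sum_(l < W) w l).
Proof.
move=> W0 c0 w.
set c := read m ccount in c0 *.
pose s := \sum_(l < W) w l.
have s0 : 0 < s.
  (* Splitting one term off the nonempty window makes the sum strictly positive. *)
  rewrite /s -(prednK W0) big_ord_recr /= ltr_wpDl ?expR_gt0 //.
  by rewrite sumr_ge0 // => l _; rewrite expR_ge0.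
rewrite /sample (mean_seq_det _ _ _ (det_weights _ _)) mean_seq_det //.
rewrite (mean_seq_det _ _ _ (det_add_weights _)) mean_seq_det // mean_seq_det //=.
set m1 := (X in mean (Flip _ _ _) X).
have cw l : (l < W)%N -> read m1 (cweight l) = w l.
  move=> lW; rewrite !read_write /= read_add_weights !read_write /=.
  by rewrite read_weights //= lW.
have s_sum : \sum_(l < W) read m1 (cweight l) = s.
  by apply: eq_bigr => l _; rewrite cw.
have cs0 : 0 < c + s by rewrite addr_gt0.
have rp : read m1 cp = s / (c + s).
  rewrite /m1 !read_write /= read_add_weights eqxx !read_write /=.
  rewrite read_weights // read_add_weights /= read_write /= !read_weights //=.
  have -> : \sum_(l < W) read (write (exec (weights d W) m) cS
      (read m (9%N, 0%N, 1%N))) (cweight l) = s.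
    by apply: eq_bigr => l _; rewrite read_write /= read_weights //= ltn_ord.
  by rewrite -/c [c + s]addrC addrK.
have rest x y z : (x < 7)%N -> read m1 (x, y, z) = read m (x, y, z).
  case: x => [|[|[|[|[|[|[|x]]]]]]] // _;
  by rewrite !read_write read_add_weights !read_write read_weights.
rewrite mean_flip rp; last first.
  by rewrite (divr_ge0 (ltW s0) (ltW cs0)) ler_pdivrMr // mul1r lerDr ltW.
rewrite mean_draw; first last.
- by rewrite big_map (_ : iota 0 W = index_iota 0 W) ?big_mkord ?s_sum // /index_iota subn0.
- apply/allP => a /mapP[l]; rewrite mem_iota => /andP[_ lW] ->.
  by rewrite cw ?expR_ge0.
rewrite big_map (_ : iota 0 W = index_iota 0 W); last by rewrite /index_iota subn0.
rewrite big_mkord s_sum size_map size_iota subn0 (mean_det _ _ (det_copy _ _ _)).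
rewrite read_copy //= ltn_ord rest // -/(cvs j).
rewrite (eq_bigr (fun l : 'I_W => w l * read m (cV l j))); last first.
  move=> l _; rewrite (nth_map 0%N) ?size_iota ?subn0 //.
  rewrite nth_iota ?subn0 // add0n cw // (mean_det _ _ (det_copy _ _ _)).
  by rewrite read_copy //= ltn_ord rest.
rewrite -/s; field.
by rewrite !gt_eqF.
Qed.

Lemma read_slide_K d W i m l (j : 'I_d) : (l < W)%N ->
  read (exec (slide d W i) m) (cK l j) =
  if (l.+1 < W)%N then read m (cK l.+1 j) else read m (ck j).
Proof.
move=> lW; rewrite /= !read_write /= !read_copy //= !read_shift /= !read_copy //=.
rewrite !ltn_ord !andbT -ltn_predRL; case: eqP => [->|]; first by rewrite ltnn.
by case: ltnP => // lW' /eqP; rewrite eqn_leq lW' -ltnS prednK ?lW //; apply: leq_trans lW.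
Qed.

Lemma read_slide_V d W i m l (j : 'I_d) : (l < W)%N ->
  read (exec (slide d W i) m) (cV l j) =
  if (l.+1 < W)%N then read m (cV l.+1 j) else read m (cv j).
Proof.
move=> lW; rewrite /= !read_write /= !read_copy //= !read_shift /= !read_copy //=.
rewrite !ltn_ord !andbT -ltn_predRL; case: eqP => [->|]; first by rewrite ltnn.
by case: ltnP => // lW' /eqP; rewrite eqn_leq lW' -ltnS prednK ?lW //; apply: leq_trans lW.
Qed.

(** Row 0 is saved before the shift overwrites it. *)
Lemma read_slide_pop d W i m (j : 'I_d) :
  read (exec (slide d W i) m) (cpop j) = read m (cV 0 j).
Proof.
by rewrite /= !read_write /= !read_copy //= !read_shift /= !read_copy //= ltn_ord.
Qed.

Lemma read_slide_other d W i m x z : x \in [:: 2; 3]%N ->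
  read (exec (slide d W i) m) (x, 0, z)%N = read m (x, 0, z)%N.
Proof.
rewrite !inE => /orP[] /eqP->;
by rewrite /= !read_write /= !read_copy //= !read_shift /= !read_copy.
Qed.

Lemma read_slide_count d W i m : read (exec (slide d W i) m) ccount = (i - W)%:R.
Proof. by rewrite /= !read_write. Qed.

Lemma exec_seq c1 c2 m : exec (Seq c1 c2) m = exec c2 (exec c1 m).
Proof. by []. Qed.

(** Steps are numbered from 1 and rows from 0, so step [i] appends at row [i.-1]. *)
Lemma read_early_K d i m l (j : 'I_d) : (l < i)%N ->
  read (exec (early_step d i) m) (cK l j) =
  if (l < i.-1)%N then read m (cK l j) else read m (ck j).
Proof.
move=> li; rewrite /early_step !exec_seq read_combine //= read_zero /= read_add_weights /=.
rewrite read_write /= read_weights //= !read_copy //= ltn_ord andbT.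
by case: i li => // i; rewrite ltnS /=; case: ltngtP.
Qed.

Lemma read_early_V d i m l (j : 'I_d) : (l < i)%N ->
  read (exec (early_step d i) m) (cV l j) =
  if (l < i.-1)%N then read m (cV l j) else read m (cv j).
Proof.
move=> li; rewrite /early_step !exec_seq read_combine //= read_zero /= read_add_weights /=.
rewrite read_write /= read_weights //= !read_copy //= ltn_ord andbT.
by case: i li => // i; rewrite ltnS /=; case: ltngtP.
Qed.

(** The formula refers to the lists in [m'], with the new pair appended, because the window
    invariant describes them in that form. This is legitimate since the blocks after the two appends
    do not touch the lists ([same]). *)
Lemma read_early_out d i m (j : 'I_d) :
  let m' := exec (early_step d i) m in
  let w l := expR (\sum_(j < d) read m (cq j) * read m' (cK l j)) in
  read m' (cout j) =
  (\sum_(l < i) w l * read m' (cV l j)) / \sum_(l < i) w l.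
Proof.
have same m0 x y z : (x < 7)%N ->
    read (exec (early_step d i) m0) (x, y, z) =
    read (exec (Seq (copy d (cK i.-1) ck) (copy d (cV i.-1) cv)) m0) (x, y, z).
  case: x => [|[|[|[|[|[|[|x]]]]]]] // _;
  by rewrite /early_step !exec_seq read_combine //= read_zero /= read_add_weights /= read_write read_weights.
move=> m' w.
set m1 := exec (Seq (copy d (cK i.-1) ck) (copy d (cV i.-1) cv)) m.
have w_val l : (l < i)%N -> read (exec (weights d i) m1) (cweight l) = w l.
  move=> li; rewrite read_weights //= li; congr expR.
  apply: eq_bigr => j' _; rewrite /m' !same // -/m1.
  by rewrite /m1 /= !read_copy.
pose m2 := exec (loop d (fun j => Const (cout j) 0))
  (exec (add_weights i) (exec (Const cS 0) (exec (weights d i) m1))).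
rewrite {1}/m' /early_step !exec_seq -[exec (copy _ (cV _) _) _]/m1 -/m2.
rewrite read_combine //= ltn_ord /= {1}/m2 read_zero /= ltn_ord /= add0r mulr_suml.
apply: eq_bigr => l _.
have -> : read m2 (cV l j) = read m' (cV l j).
  by rewrite /m' same // /m2 read_zero read_add_weights /= read_write read_weights.
have -> : read m2 (cweight l) = w l.
  by rewrite /m2 read_zero read_add_weights /= read_write /= w_val.
have -> : read m2 cS = \sum_(l < i) w l.
  rewrite /m2 read_zero read_add_weights /= read_write /= add0r.
  by apply: eq_bigr => l' _; rewrite read_write /= w_val.
by rewrite mulrAC.
Qed.

Lemma det_early_step d i : det (early_step d i).
Proof.
rewrite /early_step /= !det_copy det_weights det_add_weights /=.
by rewrite !det_loop //= => l; rewrite det_loop.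
Qed.

End Steps.

(** * The whole stream *)

Section Stream.
Variables (R : realType) (d W : nat).
Implicit Types (m : memory R) (x : triple R d) (X : seq (triple R d)).

Lemma read_store_same p (u : 'cV[R]_d) m (j : 'I_d) :
  read (store (fun j => (p, 0, j)%N) u m) (p, 0, nat_of_ord j)%N = u j 0.
Proof.
rewrite /store; have : j \in enum 'I_d by rewrite mem_enum.
elim/last_ind: (enum _) => // s k IHs; rewrite mem_rcons inE foldl_rcons read_write.
rewrite !xpair_eqE !eqxx /=; case: (eqVneq j k) => [->|jk] /=; first by rewrite eqxx.
by rewrite (negPf jk : (j == k :> nat) = false) => /IHs.
Qed.

Lemma read_store_other p (u : 'cV[R]_d) m a b z : a != p ->
  read (store (fun j => (p, 0, j)%N) u m) (a, b, z) = read m (a, b, z).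
Proof.
move=> ap; rewrite /store; elim/last_ind: (enum _) => // s k IHs.
by rewrite foldl_rcons read_write !xpair_eqE (negPf ap).
Qed.

Lemma read_receive x m a b z : (a < 3)%N ->
  read (receive x m) (a, b, z) = read m (a, b, z).
Proof. by case: a => [|[|[|a]]] // _; rewrite !read_store_other. Qed.

Lemma read_receive_cq x m (j : 'I_d) : read (receive x m) (cq j) = query x j 0.
Proof. by do 2![rewrite read_store_other //]; rewrite read_store_same. Qed.

Lemma read_receive_ck x m (j : 'I_d) : read (receive x m) (ck j) = key x j 0.
Proof. by rewrite read_store_other // read_store_same. Qed.

Lemma read_receive_cv x m (j : 'I_d) : read (receive x m) (cv j) = value x j 0.
Proof. exact: read_store_same. Qed.

Lemma expect_update i x m g :
  expect (update W i x m) (fun o => g (final o)) =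
  mean (sw_step d W i) (receive x m) g.
Proof. by rewrite expect_dbind; apply: eq_expect => o; rewrite expect_dret. Qed.

(** [process] recurses on the first triple, whereas the analysis conditions on the memory left
    before the last step. *)
Lemma expect_process_rcons i X x m f :
  expect (process W i (rcons X x) m) f =
  expect (process W i X m) (fun m' =>
    mean (sw_step d W (i + size X)) (receive x m') f).
Proof.
elim: X i m => [|y X IHX] i m.
  rewrite expect_dret addn0 -expect_update expect_dbind; apply: eq_expect => o.
  by rewrite expect_dret.
have step Y : process W i (y :: Y) m =
  dbind (update W i y m) (fun o => process W i.+1 Y (final o)) by [].
rewrite rcons_cons !step 2!expect_dbind; apply: eq_expect => o.
by rewrite IHX addnS addSn.
Qed.

Variable X : seq (triple R d).
Let x l := nth (Triple 0 0 0) X l.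
(** The law of the memory after steps 1 to [i]; the next step has number [i.+1] and receives
    [x i]. *)
Let M i := process W 1 (take i X) [fmap]%fmap.

Lemma expect_processS i f : (i < size X)%N ->
  expect (M i.+1) f =
  expect (M i) (fun m => mean (sw_step d W i.+1) (receive (x i) m) f).
Proof.
move=> iX; rewrite /M (take_nth (Triple 0 0 0)) // expect_process_rcons.
by rewrite size_take iX add1n.
Qed.

(** * Contents of the window *)

Hypothesis W_gt0 : (0 < W)%N.

(** Truncated subtraction makes [i - W] vanish while the lists still grow, so one formula covers
    both phases. *)
Definition window_stored i m := forall l (j : 'I_d), (l < minn i W)%N ->
  read m (cK l j) = key (x (i - W + l)) j 0 /\
  read m (cV l j) = value (x (i - W + l)) j 0.

Lemma window_slid i m l (j : 'I_d) : (W <= i)%N -> window_stored i m ->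
  (l < W)%N ->
  let m1 := exec (slide d W i.+1) (receive (x i) m) in
  read m1 (cK l j) = key (x (i.+1 - W + l)) j 0 /\
  read m1 (cV l j) = value (x (i.+1 - W + l)) j 0.
Proof.
move=> Wi wm lW m1; rewrite /m1 read_slide_K // read_slide_V //.
rewrite read_receive_ck read_receive_cv !read_receive //.
case: ltnP => lW'.
  (* Each row index drops by one while the start of the window advances by one. *)
  have -> : (i.+1 - W + l = i - W + l.+1)%N by lia.
  by apply: wm; rewrite (minn_idPr Wi).
by have -> : (i.+1 - W + l = i)%N by lia.
Qed.

Lemma window_early i m l (j : 'I_d) : (i < W)%N -> window_stored i m ->
  (l <= i)%N ->
  let m1 := exec (early_step d i.+1) (receive (x i) m) in
  read m1 (cK l j) = key (x l) j 0 /\ read m1 (cV l j) = value (x l) j 0.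
Proof.
move=> iW wm li m1; rewrite /m1 read_early_K // read_early_V //=.
rewrite read_receive_ck read_receive_cv !read_receive //.
case: ltnP => li'.
  have := wm l j; rewrite leq_min li' (ltn_trans li' iW).
  by rewrite (eqP (ltnW iW : i - W == 0)%N); apply.
by have -> : l = i by lia.
Qed.

Lemma sure_window_stored i m : window_stored i m ->
  sure (sw_step d W i.+1) (receive (x i) m) (window_stored i.+1).
Proof.
move=> wm; rewrite /sw_step; case: leqP => iW; last first.
  apply: sure_det => [|l j li]; first exact: det_early_step.
  have -> : (i.+1 - W + l = l)%N by lia.
  by apply: window_early => //; lia.
(* Either outcome of the reservoir coin leaves arrays 0 and 1 as [slide] left them, and [sample]
   preserves them. *)
have frame m2 : (forall a l j, (a < 2)%N -> read m2 (a, l, j) =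
      read (exec (slide d W i.+1) (receive (x i) m)) (a, l, j)) ->
    sure (sample d W) m2 (window_stored i.+1).
  move=> m2E; apply: (sureW _ (@sample_frame _ d W m2)) => o oE l j.
  rewrite leq_min => /andP[_ lW]; rewrite !oE // !m2E //.
  exact: window_slid.
apply: sure_late_step; apply: frame => // a l j a2.
by rewrite read_copy //; case: a a2 => [|[|a]].
Qed.

Lemma surely_window_stored i : (i <= size X)%N -> surely (M i) (window_stored i).
Proof.
elim: i => [|i IHi] iX.
  by rewrite /M take0; apply: surely_dret => l j; rewrite min0n.
(* Unfolding [surely] exposes two expectations from which the last step can be peeled off. *)
move=> f g fg; rewrite !expect_processS //; apply: IHi; first exact: ltnW.
move=> m wm; apply: (sure_window_stored wm) => o; exact: fg.
Qed.

(** * Means of the reservoir and of the output *)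

Lemma mean_late_cvs i m (j : 'I_d) : (W <= i)%N -> window_stored i m ->
  mean (late_step d W i.+1) (receive (x i) m) (fun m' => read m' (cvs j)) =
  (i.+1 - W)%:R^-1 * value (x (i - W)) j 0 +
  (1 - (i.+1 - W)%:R^-1) * read m (cvs j).
Proof.
move=> Wi wm; rewrite mean_late_step //.
have frame m2 : mean (sample d W) m2 (fun m' => read m' (cvs j)) = read m2 (cvs j).
  rewrite -[RHS](expect_const (run (sample d W) m2)).
  by apply: (@sample_frame _ d W m2) => o ->.
rewrite !frame read_copy //= ltn_ord read_slide_pop read_slide_other //.
rewrite !read_receive //; have i0 : (0 < minn i W)%N by rewrite (minn_idPr Wi).
(* The popped row 0 of the old list is the value at stream position [i - W]. *)
by have [_ ->] := wm 0%N j i0; rewrite addn0.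
Qed.

(** The multiplied form covers [i = W], where the reservoir is still empty and both sides are 0.
    With [c = i + 1 - W], the recurrence [c * e' = v + (c - 1) * e] adds one term to the sum. *)
Lemma expect_reservoir i (j : 'I_d) : (W <= i <= size X)%N ->
  (i - W)%:R * expect (M i) (fun m => read m (cvs j)) =
  \sum_(l < i - W) value (x l) j 0.
Proof.
elim: i => [|i IHi]; first by case: (W) W_gt0.
case/andP; rewrite leq_eqVlt => /orP[/eqP<- _|Wi iX].
  by rewrite subnn mul0r big_ord0.
rewrite ltnS in Wi; rewrite expect_processS //.
rewrite (_ : expect _ _ = expect (M i) (fun m =>
  (i.+1 - W)%:R^-1 * value (x (i - W)) j 0 +
  (1 - (i.+1 - W)%:R^-1) * read m (cvs j))); last first.
  apply: (surely_window_stored (ltnW iX)) => m wm.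
  by rewrite /sw_step leqNgt ltnS Wi mean_late_cvs.
rewrite expectD expect_const expectZ subSn // big_ord_recr /= -IHi ?Wi 1?ltnW //.
rewrite -natr1; field.
by rewrite natr1 pnatr_eq0.
Qed.

Definition score i l : R := expR (\sum_(j < d) query (x i) j 0 * key (x l) j 0).

Lemma expect_early_out i (j : 'I_d) : (i < size X)%N -> (i < W)%N ->
  expect (M i) (fun m => mean (sw_step d W i.+1) (receive (x i) m)
    (fun m' => read m' (cout j))) =
  (\sum_(l < i.+1) score i l * value (x l) j 0) / \sum_(l < i.+1) score i l.
Proof.
move=> iX iW; rewrite -[RHS](expect_const (M i)).
apply: (surely_window_stored (ltnW iX)) => m wm.
rewrite /sw_step iW mean_det ?det_early_step // read_early_out.
have w_score (l : 'I_i.+1) : expR (\sum_(j < d) read (receive (x i) m) (cq j) *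
    read (exec (early_step d i.+1) (receive (x i) m)) (cK l j)) = score i l.
  congr expR; apply: eq_bigr => j' _; rewrite read_receive_cq.
  by have [-> _] := window_early j' iW wm (leq_ord l).
congr (_ / _); apply: eq_bigr => l _; rewrite w_score //.
by have [_ ->] := window_early j iW wm (leq_ord l).
Qed.

Lemma expect_late_out i (j : 'I_d) : (i < size X)%N -> (W <= i)%N ->
  expect (M i) (fun m => mean (sw_step d W i.+1) (receive (x i) m)
    (fun m' => read m' (cout j))) =
  (\sum_(l < i.+1 - W) value (x l) j 0 +
   \sum_(l < W) score i (i.+1 - W + l) * value (x (i.+1 - W + l)) j 0) /
  ((i.+1 - W)%:R + \sum_(l < W) score i (i.+1 - W + l)).
Proof.
move=> iX Wi; set c := (i.+1 - W)%N; set N := \sum_(l < W) _ * _.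
set D := c%:R + _.
have c0 : (0 < c)%N by rewrite subn_gt0.
have D0 : 0 < D.
  by apply: ltr_wpDr; [apply: sumr_ge0 => l _; apply: expR_ge0 | rewrite ltr0n].
have cR : c%:R != 0 :> R by rewrite pnatr_eq0 -lt0n.
(* This is [(1 / c) * (c * v + N) / D + (1 - 1 / c) * (c * v_s + N) / D], with [v] the popped value,
   simplified. *)
rewrite (_ : expect _ _ = expect (M i) (fun m =>
  (value (x (i - W)) j 0 + N) / D +
  ((c%:R - 1) / D) * read m (cvs j))); last first.
  apply: (surely_window_stored (ltnW iX)) => m wm.
  rewrite /sw_step leqNgt ltnS Wi mean_late_step //.
  set m1 := exec (slide _ _ _) _.
  (* To be applied after either outcome of the reservoir coin, where the memory differs from [m1] at
     most in array 2. *)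
  have out m2 :
    (forall a l z, a \in [:: 0; 1; 3; 9]%N -> read m2 (a, l, z) = read m1 (a, l, z)) ->
    mean (sample d W) m2 (fun m' => read m' (cout j)) =
      (c%:R * read m2 (cvs j) + N) / D.
    move=> m2E; have ccE : read m2 ccount = c%:R by rewrite m2E // read_slide_count.
    rewrite mean_sample_out ?ccE ?ltr0n //.
    have w_score (l : 'I_W) : expR (\sum_(j < d) read m2 (cq j) *
        read m2 (cK l j)) = score i (c + l).
      congr expR; apply: eq_bigr => j' _; rewrite !m2E // read_slide_other //.
      rewrite read_receive_cq.
      by have [-> _] := window_slid j' Wi wm (ltn_ord l).
    congr ((_ + _) / (_ + _)); apply: eq_bigr => l _; rewrite w_score //.
    by rewrite !m2E //; have [_ ->] := window_slid j Wi wm (ltn_ord l).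
  rewrite !out //; last first.
    by move=> a l z; rewrite !inE => /or4P[] /eqP->; rewrite read_copy.
  rewrite read_copy //= ltn_ord read_slide_pop read_slide_other //.
  rewrite !read_receive //; have i0 : (0 < minn i W)%N by rewrite (minn_idPr Wi).
  have [_ ->] := wm 0%N j i0; rewrite addn0; field.
  by rewrite cR gt_eqF.
rewrite expectD expect_const expectZ mulrAC.
(* The coefficient of [v_s] is exactly the factor in [expect_reservoir]. *)
have -> : c%:R - 1 = (i - W)%:R :> R by rewrite /c subSn // -natr1 addrK.
rewrite expect_reservoir ?Wi 1?ltnW // -mulrDl; congr (_ / _).
(* The popped value is the last term of the sum over the positions outside the new window. *)
by rewrite /c subSn // big_ord_recr /= [LHS]addrC addrA.
Qed.

End Stream.

(** * Space and time *)

Section Resources.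
Variables (R : realType) (d W : nat).
Implicit Types (m : memory R) (x : triple R d) (X : seq (triple R d)).

(** Arrays 0 and 1, the two lists, have [W] rows; arrays 2 to 7 have one row each. *)
Let rows : seq (nat * nat) :=
  [seq (a, l) | a <- iota 0 2, l <- iota 0 W] ++ [seq (a, 0)%N | a <- iota 2 6].

Let cell_seq : seq addr :=
  [seq (r, j) | r <- rows, j <- iota 0 d] ++
  [seq cweight l | l <- iota 0 W] ++ [:: cS; ccount; cp; ctmp].

Definition cells : {fset addr} := [fset a in cell_seq]%fset.

(** There are [2 * W + 6] rows of [d] cells, [W] weights and 4 registers, and
    [2 + 6 + 1 + 4 = 13]. *)
Lemma card_cells : (0 < d)%N -> (0 < W)%N -> (#|` cells| <= 13 * (d * W))%N.
Proof.
move=> d0 W0; apply: (@leq_trans (size cell_seq)).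
  by rewrite /cells card_fseq size_undup.
rewrite /cell_seq /rows !size_cat (size_allpairs (fun r j => (r, j))) !size_map.
rewrite size_cat (size_allpairs (fun a l => (a, l))) /= !size_iota.
nia.
Qed.

Lemma row_in_cells a l j : (a < 8)%N -> (if (a < 2)%N then l < W else l == 0)%N ->
  (j < d)%N -> (a, l, j) \in cells.
Proof.
move=> a8 al jd; rewrite in_fset /= mem_cat (_ : (a, l, j) \in _) //.
apply: (@allpairs_f _ _ _ (fun r j => (r, j))); last by rewrite mem_iota.
rewrite mem_cat; case: ltnP al => [a2 lW|a2 /eqP->].
  by rewrite (@allpairs_f _ _ _ (fun a l => (a, l))) ?mem_iota.
by rewrite orbC (@map_f _ _ (fun a => (a, 0)%N)) // mem_iota a2.
Qed.

Lemma weight_in_cells l : (l < W)%N -> cweight l \in cells.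
Proof.
move=> lW; rewrite in_fset /= !mem_cat (map_f cweight) ?orbT //.
by rewrite mem_iota.
Qed.

Lemma register_in_cells a : a \in [:: cS; ccount; cp; ctmp] -> a \in cells.
Proof. by move=> aS; rewrite in_fset /= !mem_cat aS !orbT. Qed.

Lemma safe_copy dst src : (forall j, (j < d)%N -> dst j \in cells) ->
  safe R cells (copy d dst src) d.
Proof.
move=> dstA; rewrite -[X in safe _ _ _ X]muln1; apply: safe_loop => j jd.
exact/safe_move/dstA.
Qed.

Lemma safe_shift A : (forall l j, (l < W)%N -> (j < d)%N -> A l j \in cells) ->
  safe R cells (shift d W A) (W * d).
Proof.
move=> AA; apply: (@safe_le _ _ _ (W.-1 * d)); first by rewrite leq_mul2r leq_pred orbT.
by apply: safe_loop => l lW; apply: safe_copy => j; apply: AA; lia.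
Qed.

Lemma safe_weights len : (len <= W)%N ->
  safe R cells (weights d len) (len * (1 + (d * 2 + 1))).
Proof.
move=> lenW; apply: safe_loop => l ll.
have lA : cweight l \in cells by apply: weight_in_cells; apply: leq_trans lenW.
apply: safe_seq; first exact: safe_const.
apply: safe_seq; last exact: safe_exp.
apply: safe_loop => j _; apply: (safe_seq (T1 := 1) (T2 := 1)).
  by apply/safe_arith/register_in_cells.
exact: safe_arith.
Qed.

Lemma safe_add_weights len : safe R cells (add_weights len) (len * 1).
Proof. by apply: safe_loop => l _; apply/safe_arith/register_in_cells. Qed.

(** The factor [d.+1] absorbs the costs that do not depend on [d], so the bound also holds for
    [d = 0]. *)
Lemma safe_early_step i : (0 < i <= W)%N ->
  exists2 T, safe R cells (early_step d i) T & (T <= 20 * (d.+1 * W))%N.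
Proof.
(* The time bound stays open: the structure of the command fills it in, and only the resulting
   polynomial is compared with the claim. *)
case/andP=> i0 iW; eexists.
  apply: safe_seq; first by apply: safe_copy => j jd; apply: row_in_cells => //=; lia.
  apply: safe_seq; first by apply: safe_copy => j jd; apply: row_in_cells => //=; lia.
  apply: safe_seq; first exact: safe_weights.
  apply: safe_seq; first by apply/safe_const/register_in_cells.
  apply: safe_seq; first exact: safe_add_weights.
  apply: safe_seq.
    by apply: safe_loop => j jd; apply/safe_const/row_in_cells.
  apply: safe_loop => l li; apply: safe_seq.
    by apply/safe_arith/register_in_cells.
  apply: safe_loop => j jd; apply: safe_seq.
    by apply/safe_arith/register_in_cells.
  by apply/safe_arith/row_in_cells.
nia.
Qed.

Lemma safe_late_step i : (0 < W)%N ->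
  exists2 T, safe R cells (late_step d W i) T & (T <= 20 * (d.+1 * W))%N.
Proof.
move=> W0; eexists.
  apply: safe_seq; first by apply: safe_copy => j jd; apply: row_in_cells.
  apply: safe_seq; first by apply: safe_shift => l j lW jd; apply: row_in_cells.
  apply: safe_seq; first by apply: safe_shift => l j lW jd; apply: row_in_cells.
  apply: safe_seq; first by apply: safe_copy => j jd; apply: row_in_cells => //=; lia.
  apply: safe_seq; first by apply: safe_copy => j jd; apply: row_in_cells => //=; lia.
  apply: safe_seq; first by apply/safe_const/register_in_cells.
  apply: safe_seq; first by apply/safe_const/register_in_cells.
  apply: safe_seq; first by apply/safe_arith/register_in_cells.
  apply: safe_seq.
    apply: safe_flip; first by apply: safe_copy => j jd; apply: row_in_cells.
    (* [safe_flip] asks for a common bound, so the cost of [Skip] is padded to [d]. *)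
    by apply: (safe_le (leq0n d)); apply: safe_skip.
  apply: safe_seq; first exact: safe_weights.
  apply: safe_seq; first by apply/safe_move/register_in_cells.
  apply: safe_seq; first exact: safe_add_weights.
  apply: safe_seq; first by apply/safe_arith/register_in_cells.
  apply: safe_seq; first by apply/safe_arith/register_in_cells.
  apply: safe_flip.
    by apply: safe_draw => l; apply: safe_copy => j jd; apply: row_in_cells.
  (* Same padding, up to the cost of the branch that draws. *)
  apply: (safe_le (leq_addl _ d)); apply: safe_copy => j jd; exact: row_in_cells.
rewrite size_map size_iota; nia.
Qed.

Lemma safe_sw_step i : (0 < W)%N -> (0 < i)%N ->
  safe R cells (sw_step d W i) (20 * (d.+1 * W)).
Proof.
move=> W0 i0; rewrite /sw_step; case: leqP => iW.
  by have [|T sT TT] := @safe_early_step i; [rewrite i0|apply: safe_le sT].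
by have [T sT TT] := @safe_late_step i W0; apply: safe_le sT.
Qed.

Lemma store_subset p (u : 'cV[R]_d) m : (1 < p < 8)%N ->
  (domf m `<=` cells)%fset ->
  (domf (store (fun j => (p, 0, j)%N) u m) `<=` cells)%fset.
Proof.
move=> /andP[p1 p8] mA; rewrite /store; elim/last_ind: (enum _) => // s k IHs.
rewrite foldl_rcons; apply: write_sub => //.
by apply: row_in_cells => //; rewrite ltnNge p1.
Qed.

Lemma update_safe i x m : (0 < W)%N -> (0 < i)%N -> (domf m `<=` cells)%fset ->
  surely (update W i x m) (fun o => [/\ (domf (final o) `<=` cells)%fset,
    peak o <= #|` cells| & time o <= 3 * d + 20 * (d.+1 * W)]%N).
Proof.
move=> W0 i0 mA; have rA : (domf (receive x m) `<=` cells)%fset.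
  by do 3![apply: store_subset => //].
by apply: safe_charged => //; apply: safe_sw_step.
Qed.

Lemma process_subset i X m : (0 < W)%N -> (0 < i)%N -> (domf m `<=` cells)%fset ->
  surely (process W i X m) (fun m' => domf m' `<=` cells)%fset.
Proof.
move=> W0; elim: X i m => [|x X IHX] i m i0 mA; first exact: surely_dret.
apply: surely_dbind (update_safe x W0 i0 mA) _ => o [oA _ _].
exact: IHX.
Qed.

Lemma sw_law_safe n (s : n.-tuple (triple R d)) (i : 'I_n) : (0 < W)%N ->
  surely (sw_law W s i) (fun o => peak o <= #|` cells| /\
    time o <= 3 * d + 20 * (d.+1 * W))%N.
Proof.
move=> W0; have e0 : (domf ([fmap]%fmap : memory R) `<=` cells)%fset by rewrite fsub0set.
apply: surely_dbind (process_subset (take i s) W0 (ltn0Sn 0) e0) _ => m mA.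
by apply: surelyW (update_safe _ W0 (ltn0Sn i) mA) => o [].
Qed.

End Resources.

(** * The attention as a weighted mean, and the theorem *)

Lemma attn_prefix (R : realType) (d W n : nat) (s : n.-tuple (triple R d))
    (i : 'I_n) (j : 'I_d) :
  let x := nth (Triple 0 0 0) s in
  let w l := if (i.+1 < l.+1 + W)%N then score s i l else 1 in
  attn W (query (tnth s i)) (prefix_mx (fun l => key (tnth s l)) i)
    (prefix_mx (fun l => value (tnth s l)) i) 0 j =
  (\sum_(l < i.+1) w l * value (x l) j 0) / \sum_(l < i.+1) w l.
Proof.
move=> x w.
have tnthE (l : 'I_n) : tnth s l = x l by apply: tnth_nth.
rewrite /attn; set h := map2_mx _ _ _.
have hE (l : 'I_i.+1) : expR (h l 0) = w l.
  (* Outside the window the mask turns the score into 0, which gives weight [exp 0 = 1]. *)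
  rewrite !mxE /w; case: ifP => _; last by rewrite mulr0 expR0.
  rewrite mulr1; congr expR; apply: eq_bigr => j' _.
  by rewrite !mxE !tnthE mulrC.
have sE l : softmax h l 0 = w l / \sum_(l' < i.+1) w l'.
  by rewrite mxE hE; congr (_ / _); apply: eq_bigr => l' _; rewrite hE.
rewrite mxE mulr_suml; apply: eq_bigr => l _.
by rewrite [X in X * _]mxE sE !mxE tnthE mulrAC.
Qed.

Theorem theorem24 (R : realType) :
  (forall (d W n : nat) (s : n.-tuple (triple R d)) (i : 'I_n) (j : 'I_d),
     (0 < W)%N ->
     expect (sw_law W s i) (fun o => output o j) =
     attn W (query (tnth s i))
       (prefix_mx (fun l => key (tnth s l)) i)
       (prefix_mx (fun l => value (tnth s l)) i) 0 j) /\
  (exists C : nat,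
     forall (d W n : nat) (s : n.-tuple (triple R d)) (i : 'I_n),
     (0 < d)%N -> (0 < W)%N ->
     prob (sw_law W s i) (fun o => (peak o <= C * (d * W))%N) = 1 /\
     prob (sw_law W s i) (fun o => (time o <= C * (d * W))%N) = 1).
Proof.
split=> [d W n s i j W0|].
  have is_ : (i < size s)%N by rewrite size_tuple.
  rewrite attn_prefix expect_dbind (tnth_nth (Triple 0 0 0)).
  under eq_expect => m do rewrite (expect_update _ _ _ _ (fun m' => read m' (cout j))).
  case: (ltnP i W) => iW.
    rewrite expect_early_out //; congr (_ / _); apply: eq_bigr => l _;
    by rewrite ifT //; lia.
  rewrite expect_late_out //; set c := (i.+1 - W)%N.
  have cW : (c + W = i.+1)%N by rewrite subnK // ltnW.
  (* The first [c] positions lie outside the window, the last [W] inside. *)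
  have split_sum (F : nat -> R) :
      \sum_(l < i.+1) F l = \sum_(l < c) F l + \sum_(l < W) F (c + l)%N.
    by rewrite -cW big_split_ord.
  pose w l : R := if (i.+1 < l.+1 + W)%N then score s i l else 1.
  rewrite (split_sum (fun l => w l * value (nth (Triple 0 0 0) s l) j 0)).
  rewrite (split_sum w) /w.
  congr ((_ + _) / (_ + _)).
  - by apply: eq_bigr => l _; rewrite ifF ?mul1r //; have := ltn_ord l; lia.
  - by apply: eq_bigr => l _; rewrite ifT //; lia.
  - rewrite (eq_bigr (fun=> 1)) ?sumr_const ?card_ord // => l _.
    by rewrite ifF //; have := ltn_ord l; lia.
  - by apply: eq_bigr => l _; rewrite ifT //; lia.
(* As [d] and [W] are positive, [3 * d + 20 * (d.+1 * W)] is at most [(3 + 40) * (d * W)]; the space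
   needs only 13. *)
exists 43%N => d W n s i d0 W0.
by split; apply: surely_prob; apply: surelyW (sw_law_safe s i W0) => o [pk tm];
  [apply: leq_trans pk _; apply: leq_trans (card_cells d0 W0) _
  |apply: leq_trans tm _]; nia.
Qed.
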